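(* Let $n\ge 1$ and $\sigma\in\mathfrak{S}_n$. Then $\phi^{-1}(\sigma)=f=f_1f_2\cdots f_n$, where for every $i\in[n]$, $f_i=\sigma^{t}(i)$ and $t$ is the smallest positive integer such that $\sigma^{t}(i)\le i$.
   Context: $[n]=\{1,\dots,n\}$ and $\mathfrak{S}_n$ is the symmetric group on $[n]$. Products of permutations are composed with the leftmost factor acting first: $(\alpha\beta)(x)=\beta(\alpha(x))$. A function $f:[n]\to[n]$ is subexceedant if $1\le f(i)\le i$ for all $i$; it is written as the word $f_1f_2\cdots f_n$ with $f_i=f(i)$, and $F_n$ denotes the set of subexceedant functions on $[n]$. The map $\phi:F_n\to\mathfrak{S}_n$ is defined by $\phi(f)=(1,f_1)(2,f_2)\cdots(n,f_n)$, a product of transpositions, where $(i,i)$ denotes the identity; $\phi$ is a bijection. *)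

(* Defs.v *)
From HB Require Import structures.
From mathcomp Require Import all_boot all_fingroup.

Set Implicit Arguments.
Unset Strict Implicit.
Unset Printing Implicit Defensive.

(* The set [n] = {1, ..., n} is represented by 'I_n = {0, ..., n - 1} through  *)
(* the order isomorphism i |-> i - 1; the condition 1 <= f(i) <= i then reads *)
(* f i <= i.                                                                  *)
Definition subexceedant n (f : {ffun 'I_n -> 'I_n}) : bool :=
  [forall i : 'I_n, f i <= i].

Record subexc n := Subexc {
  subexc_ffun :> {ffun 'I_n -> 'I_n};
  subexc_proof : subexceedant subexc_ffun }.

HB.instance Definition _ n := [isSub for @subexc_ffun n].
HB.instance Definition _ n := [Finite of subexc n by <:].

(* MathComp composes permutations with the left factor acting first           *)
(* (permM : (s * t) x = t (s x)), and this ordered product runs over          *)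
(* increasing i; tperm i i = 1.                                               *)
Definition phi n (f : subexc n) : 'S_n := (\prod_(i < n) tperm i (f i))%g.

Section PhiBijective.

Variable n : nat.

Definition phi_upto (f : {ffun 'I_n.+1 -> 'I_n.+1}) (k : nat) : 'S_n.+1 :=
  (\prod_(0 <= j < k) tperm (inord j) (f (inord j)))%g.

Lemma phi_uptoE (f : subexc n.+1) : phi f = phi_upto f n.+1.
Proof.
rewrite /phi /phi_upto big_mkord.
by apply: eq_bigr => i _; rewrite inord_val.
Qed.

Lemma phi_uptoS f k :
  phi_upto f k.+1 = (phi_upto f k * tperm (inord k) (f (inord k)))%g.
Proof. by rewrite /phi_upto big_nat_recr. Qed.

Lemma phi_upto_fix (f : {ffun 'I_n.+1 -> 'I_n.+1}) k (x : 'I_n.+1) :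
  subexceedant f -> k <= x -> phi_upto f k x = x.
Proof.
move=> /forallP sf; elim: k => [|k IHk] ltkx.
  by rewrite /phi_upto big_geq // perm1.
have vk : (inord k : 'I_n.+1) = k :> nat.
  by rewrite inordK // (ltn_trans ltkx).
rewrite phi_uptoS permM IHk ?(ltnW ltkx) // tpermD // -val_eqE /=.
  by rewrite vk neq_ltn ltkx.
by rewrite neq_ltn (leq_ltn_trans (sf _)) ?vk.
Qed.

Lemma phi_upto_inj (f g : {ffun 'I_n.+1 -> 'I_n.+1}) k :
  subexceedant f -> subexceedant g -> k <= n.+1 ->
  phi_upto f k = phi_upto g k -> forall x : 'I_n.+1, x < k -> f x = g x.
Proof.
move=> sf sg; elim: k => [|k IHk] // ltkn eqfg.
have vk : (inord k : 'I_n.+1) = k :> nat by rewrite inordK.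
have fgk : f (inord k) = g (inord k).
  move/permP/(_ (inord k)): eqfg.
  by rewrite !phi_uptoS !permM !phi_upto_fix ?vk // !tpermL.
have eqk : phi_upto f k = phi_upto g k.
  by move: eqfg; rewrite !phi_uptoS fgk => /mulIg.
move=> x; rewrite ltnS leq_eqVlt => /orP[/eqP xk|]; last exact: IHk (ltnW _) _ _.
by rewrite (_ : x = inord k) // -xk inord_val.
Qed.

Lemma phi_upto_surj k (s : 'S_n.+1) :
  k <= n.+1 -> (forall x : 'I_n.+1, k <= x -> s x = x) ->
  exists2 f, subexceedant f & phi_upto f k = s.
Proof.
elim: k s => [|k IHk] s ltkn sfix.
  exists [ffun x => x]; first by apply/forallP=> x; rewrite ffunE.
  by apply/permP=> x; rewrite /phi_upto big_geq // perm1 sfix.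
have vk : (inord k : 'I_n.+1) = k :> nat by rewrite inordK.
have sk : s (inord k) <= k.
  rewrite leqNgt; apply/negP=> lt; have := perm_inj (sfix _ lt).
  by move=> eqs; move: lt; rewrite eqs vk ltnn.
have [x lekx|f sf fs] := IHk (s * tperm (inord k) (s (inord k)))%g (ltnW ltkn).
  rewrite permM; move: lekx; rewrite leq_eqVlt => /orP[/eqP kx|ltkx].
    by rewrite kx inord_val tpermR.
  rewrite (sfix x) ?tpermD // -val_eqE /= neq_ltn ?vk ?ltkx //.
  by rewrite (leq_ltn_trans sk).
exists [ffun x => if x == inord k then s (inord k) else f x].
  apply/forallP=> x; rewrite ffunE; case: eqP => [->|_]; first by rewrite vk.
  exact: (forallP sf).
rewrite phi_uptoS ffunE eqxx.
rewrite (_ : phi_upto _ k = phi_upto f k); last first.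
  apply: eq_big_nat => j /andP[_ ltjk]; rewrite ffunE -val_eqE /= vk.
  by rewrite inordK ?(ltn_trans ltjk) // ltn_eqF.
by rewrite fs -mulgA tperm2 mulg1.
Qed.

End PhiBijective.

Lemma phi_inj n : injective (@phi n).
Proof.
case: n => [|n] f g; first by move=> _; apply/val_inj/ffunP; case.
rewrite !phi_uptoE => eqfg; apply/val_inj/ffunP=> x /=.
exact: phi_upto_inj (subexc_proof f) (subexc_proof g) (leqnn _) eqfg _ _.
Qed.

Lemma phi_surj n (s : 'S_n) : s \in codom (@phi n).
Proof.
case: n s => [|n] s.
  have sf : subexceedant [ffun x : 'I_0 => x] by apply/forallP; case.
  by apply/codomP; exists (Subexc sf); apply/permP; case.
have [x|f sf fs] := @phi_upto_surj n n.+1 s (leqnn _).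
  by rewrite leqNgt ltn_ord.
by apply/codomP; exists (Subexc sf); rewrite phi_uptoE.
Qed.

Definition phi_inv n (s : 'S_n) : subexc n := iinv (phi_surj s).

Lemma phiK n : cancel (@phi n) (@phi_inv n).
Proof. by move=> f; apply: phi_inj; rewrite f_iinv. Qed.

Lemma phi_invK n : cancel (@phi_inv n) (@phi n).
Proof. by move=> s; rewrite f_iinv. Qed.

Lemma phi_bij n : bijective (@phi n).
Proof. by exists (@phi_inv n); [apply: phiK | apply: phi_invK]. Qed.

(* Main.v *)
Require Import Defs.
From mathcomp Require Import all_boot all_fingroup.

(** For each [k], the partial product [(1,f_1)...(k,f_k)] is the first-return
    map of [s] to the first [k] points: removing the last transposition
    [(k,f_k)] from the product short-circuits the passage of an orbit through
    the point [k].  Since the product of the first [k-1] factors fixes [k],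
    the product of the first [k] factors sends [k] to [f_k], so [f_k] is the
    first return of [k] to [{1,...,k}]. *)

Definition first_return {n} (s : 'S_n) (k : nat) (x y : 'I_n) : Prop :=
  exists t : nat,
    [/\ 0 < t, (s ^+ t)%g x = y, y < k
      & forall u : nat, 0 < u < t -> k <= (s ^+ u)%g x].

Lemma first_return_weaken {n} {s : 'S_n} {k} {x y : 'I_n} :
  first_return s k.+1 x y -> y < k -> first_return s k x y.
Proof.
move=> [t [t0 st _ tmin]] ltyk; exists t; split=> // u /tmin.
exact: ltnW.
Qed.

(** The intermediate points of both returns lie above [y], and the junction [y] itself no longer
    counts once the bound drops to [y]; so the two times add up. *)
Lemma first_return_trans {n} {s : 'S_n} {x y z : 'I_n} :
  first_return s y.+1 x y -> first_return s y.+1 y z -> z < y ->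
  first_return s y x z.
Proof.
move=> [t [t0 st _ tmin]] [t' [t'0 st' _ t'min]] ltzy.
exists (t + t'); split=> //; first by rewrite addn_gt0 t0.
  by rewrite expgD permM st.
move=> u /andP[u0 ltu]; case: (ltngtP u t) => [ltut|ltut|->].
- by rewrite ltnW // tmin // u0.
- rewrite -(subnKC (ltnW ltut)) expgD permM st ltnW // t'min //.
  by rewrite subn_gt0 ltut ltn_subLR // ltnW.
- by rewrite st.
Qed.

Lemma phi_upto_diag n (f : {ffun 'I_n.+1 -> 'I_n.+1}) (i : 'I_n.+1) :
  subexceedant f -> phi_upto f i.+1 i = f i.
Proof. by move=> sf; rewrite phi_uptoS permM phi_upto_fix // inord_val tpermL. Qed.

Lemma phi_upto_pred n (f : {ffun 'I_n.+1 -> 'I_n.+1}) (i : 'I_n.+1) :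
  phi_upto f i = (phi_upto f i.+1 * tperm i (f i))%g.
Proof. by rewrite phi_uptoS inord_val -mulgA tperm2 mulg1. Qed.

Lemma phi_upto_first_return n (f : subexc n.+1) k (x : 'I_n.+1) :
  k <= n.+1 -> x < k -> first_return (phi f) k x (phi_upto f k x).
Proof.
have sf := subexc_proof f.
(* Downward induction on [k], from the full product [phi f], where every point returns after one
   step. *)
move=> /subnKC; move: (n.+1 - k) => d; elim: d k x => [|d IHd] k x eqk ltxk.
  rewrite addn0 in eqk; rewrite eqk -phi_uptoE.
  by exists 1; split=> // -[|[]].
have ltkn : k < n.+1 by rewrite -eqk addnS ltnS leq_addr.
have {eqk} ret (y : 'I_n.+1) : y < k.+1 ->
    first_return (phi f) k.+1 y (phi_upto f k.+1 y).
  by apply: IHd; rewrite addSnnS.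
pose i := Ordinal ltkn; rewrite -[k]/(val i) in ltxk ret *.
have neq_xi : x != i by rewrite -val_eqE neq_ltn ltxk.
have retx := ret x (ltnW ltxk); have reti := ret i (leqnn _).
rewrite phi_upto_diag // in reti.
(* If [x] returns to the removed point [i], its orbit goes on to [f i]; otherwise its return is
   already below [i]. *)
rewrite phi_upto_pred permM; have [eqxi|neqi] := eqVneq (phi_upto f i.+1 x) i.
  rewrite eqxi tpermL; rewrite eqxi in retx.
  apply: first_return_trans retx reti _.
  (* [f i = i] would give [x] and [i] the same image under the partial product. *)
  rewrite ltn_neqAle (forallP sf) andbT val_eqE -[f i](phi_upto_diag _ f) //.
  by rewrite -[X in _ != X]eqxi (inj_eq perm_inj) eq_sym.
rewrite tpermD; first 1 last.
- by rewrite eq_sym.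
- by rewrite -phi_upto_diag // (inj_eq perm_inj) eq_sym.
apply: first_return_weaken => //.
by case: retx => t [_ _ + _]; rewrite ltnS leq_eqVlt val_eqE (negPf neqi).
Qed.

Theorem theorem3p1 (n : nat) (hn : 1 <= n) (s : 'S_n) (i : 'I_n) :
  exists t : nat,
    [/\ 0 < t, (s ^+ t)%g i <= i,
        forall u : nat, 0 < u -> (s ^+ u)%g i <= i -> t <= u
      & phi_inv s i = (s ^+ t)%g i].
Proof.
case: n hn s i => // n _ s i.
(* Indices start at 0, so being below the bound [i.+1] means [<= i]. *)
have := @phi_upto_first_return n (phi_inv s) i.+1 i (ltn_ord i) (leqnn _).
rewrite phi_upto_diag ?subexc_proof // phi_invK => -[t [t0 st lei tmin]].
exists t; split=> //; first by rewrite st.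
move=> u u0 leu; rewrite leqNgt; apply/negP=> ltut.
by have := tmin u; rewrite u0 ltut ltnNge leu => /(_ isT).
Qed.
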